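(* Let $d\ge1$ and let $C,\mu>0$. There is a constant $C_{d,\mu}>0$ (depending only on $d$, $\mu$ and $C$) such that the following holds for every $n\ge1$. Let $X=\{x_1,\dots,x_{2n}\}\subset\mathbb{Z}^d$ be a set of $2n$ distinct points and let $\{m_{jk}\}_{1\le j,k\le 2n}$ be complex numbers with $$|m_{jk}|\le C e^{-\mu|x_j-x_k|}\qquad(1\le j,k\le 2n).$$ Then $$\frac{1}{n!}\sum_{\pi\in S_{2n}}\prod_{j=1}^n|m_{\pi(2j-1)\,\pi(2j)}|\le C_{d,\mu}^n\,e^{-\frac{\mu}{2\sqrt d}D_s(X)}.$$
   Context: $|x-y|$ is the Euclidean distance on $\mathbb{Z}^d$, $S_{2n}$ is the symmetric group on $\{1,\dots,2n\}$, and for $X=\{x_1,\dots,x_{2n}\}$, $D_s(X):=\min_{\pi\in S_{2n}}\sum_{j=1}^n|x_{\pi(2j-1)}-x_{\pi(2j)}|$. *)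

(* Defs.v *)
From HB Require Import structures.
From mathcomp Require Import all_boot all_order all_algebra all_fingroup.
From mathcomp Require Import complex reals sequences exp.

Set Implicit Arguments.
Unset Strict Implicit.
Unset Printing Implicit Defensive.

Import Order.TTheory GRing.Theory Num.Theory.
Local Open Scope ring_scope.

Definition edist (R : realType) (d : nat) (x y : 'rV[int]_d) : R :=
  Num.sqrt (\sum_(i < d) ((x 0 i - y 0 i)%:~R) ^+ 2).

(* Indices are 0-based: the points x_1, ..., x_{2n} are indexed by 'I_(n.*2),
   and for j : 'I_n the positions 2j-1 and 2j of the usual 1-based convention
   become j.*2 and j.*2.+1. *)
Lemma pair_fst_subproof (n : nat) (j : 'I_n) : (j.*2 < n.*2)%N.
Proof. by rewrite ltn_double. Qed.

Lemma pair_snd_subproof (n : nat) (j : 'I_n) : (j.*2.+1 < n.*2)%N.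
Proof. by rewrite ltn_Sdouble. Qed.

Definition pair_fst (n : nat) (j : 'I_n) : 'I_(n.*2) :=
  Ordinal (pair_fst_subproof j).

Definition pair_snd (n : nat) (j : 'I_n) : 'I_(n.*2) :=
  Ordinal (pair_snd_subproof j).

Definition pairing_length (R : realType) (d n : nat)
    (x : 'I_(n.*2) -> 'rV[int]_d) (s : 'S_(n.*2)) : R :=
  \sum_(j < n) edist R (x (s (pair_fst j))) (x (s (pair_snd j))).

(* The default value of the iterated minimum is the value at the identity
   permutation, so this is the minimum over all of 'S_(n.*2). *)
Definition Ds (R : realType) (d n : nat) (x : 'I_(n.*2) -> 'rV[int]_d) : R :=
  \big[Order.min/pairing_length R x 1%g]_(s : 'S_(n.*2)) pairing_length R x s.

(* Main.v *)
(** Since sqrt d >= 1 and D_s(X) is at most the length L of any pairing,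
    exp (- mu L) <= exp (- (mu / (2 sqrt d)) D_s(X)) * exp (- (mu / 2) L), so it
    remains to sum exp (- (mu / 2) L) over all permutations.  A permutation is
    determined by the injection f listing the first elements of its pairs and
    the map g listing the second ones; forgetting that g must be injective, the
    sum over g factorises into n sums, each at most
    S = sum_(z in Z^d) exp (- (mu / 2) |z|), while there are
    n! 'C(2 n, n) <= n! 4 ^ n choices for f. *)
Require Import Defs.
From HB Require Import structures.
From mathcomp Require Import all_boot all_order all_algebra all_fingroup.
From mathcomp Require Import complex reals sequences exp.

Set Implicit Arguments.
Unset Strict Implicit.
Unset Printing Implicit Defensive.

Import Order.TTheory GRing.Theory Num.Theory.
Local Open Scope ring_scope.

(** Serves twice to enlarge a sum of nonnegative terms to an index set on which it factorises:
    lattice points to coordinate codes, permutations to pairs of maps. *)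
Lemma ler_sum_inj (R : numDomainType) (I J : finType) (P : pred J)
    (h : I -> J) (F : J -> R) :
  injective h -> (forall i, P (h i)) -> (forall j, P j -> 0 <= F j) ->
  \sum_i F (h i) <= \sum_(j | P j) F j.
Proof.
move=> hI hP F0.
have -> : \sum_i F (h i) = \sum_(j in [set h i | i : I]) F j.
  by rewrite big_imset //= => i j _ _ /hI.
rewrite [leRHS](bigID (fun j => j \in [set h i | i : I])) /=.
rewrite (eq_bigl (fun j => P j && (j \in [set h i | i : I]))) => [|j].
  by rewrite lerDl sumr_ge0 // => j /andP[/F0].
by apply/idP/andP => [|[]//] jh; split=> //; case/imsetP: jh => i _ ->.
Qed.

(** Subsets of a fixed size are among all subsets of an [m]-element set. *)
Lemma leq_bin_exp2 (m n : nat) : ('C(m, n) <= 2 ^ m)%N.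
Proof.
have := card_draws 'I_m n; rewrite card_ord => <-.
apply: leq_trans (max_card _) _.
by rewrite -cardsT -powersetT card_powerset cardsT card_ord.
Qed.

Lemma geometric_sum_le (R : numFieldType) (q : R) (N : nat) :
  0 <= q < 1 -> \sum_(i < N) q ^+ i <= (1 - q)^-1.
Proof.
case/andP=> q0 q1; have q1' : 0 < 1 - q by rewrite subr_gt0.
rewrite -(ler_pM2l q1') divff ?gt_eqF // -opprB mulNr -subrX1 opprB.
by rewrite lerBlDr lerDl exprn_ge0.
Qed.

(** A sign and a magnitude, so that a sum over codes is two geometric sums. As [Negz k] is [-(k+1)],
    the magnitude stored for a negative integer is one less than its absolute value. *)
Definition int_code (N : nat) (z : int) : bool * 'I_N.+1 :=
  match z with Posz k => (false, inord k) | Negz k => (true, inord k) end.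

Lemma int_code_inj (N : nat) :
  {in [pred z : int | (`|z| <= N)%N] &, injective (int_code N)}.
Proof.
move=> [a|a] [b|b]; rewrite !inE => aN bN //= [] /(congr1 val) /=.
- by rewrite !inordK // => ->.
- by rewrite !inordK ?ltnS 1?ltnW // => ->.
Qed.

(** A finite family of distinct points lies in a box of some radius [N]. The sum over the box
    factorises over coordinates, each factor being two truncated geometric series, so the bound
    depends on neither [N] nor [I]. *)
Lemma lattice_sum_le (R : numFieldType) (q : R) (d : nat) (I : finType)
    (z : I -> 'rV[int]_d) :
  0 <= q < 1 -> injective z ->
  \sum_k \prod_(i < d) q ^+ absz (z k 0 i) <= (2 / (1 - q)) ^+ d.
Proof.
move=> q01 zI; have /andP[q0 q1] := q01.
pose N := (\max_k \max_(i < d) absz (z k ord0 i))%N.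
have zN k i : (absz (z k ord0 i) <= N)%N.
  apply: leq_trans (leq_bigmax k).
  exact: (leq_bigmax (F := fun i => absz (z k ord0 i))).
pose h k := [ffun i : 'I_d => int_code N (z k 0 i)].
have hI : injective h.
  move=> k l /ffunP hkl; apply/zI/rowP => i.
  by have := hkl i; rewrite !ffunE => /int_code_inj; apply; rewrite inE zN.
pose F (f : {ffun 'I_d -> bool * 'I_N.+1}) := \prod_(i < d) q ^+ (f i).2.
apply: (@le_trans _ _ (\sum_k F (h k))).
  apply: ler_sum => k _; apply: ler_prod => i _; rewrite exprn_ge0 //= ffunE.
  (* The stored magnitude is at most the absolute value, and powers of [q] decrease. *)
  apply: ler_wiXn2l => //; first exact: ltW.
  have := zN k i; case: (z k 0 i) => a aN /=; rewrite inordK //.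
  by rewrite ltnS ltnW.
apply: (@le_trans _ _ (\sum_f F f)).
  apply: (ler_sum_inj (P := xpredT)) => // f _.
  by apply: prodr_ge0 => i _; rewrite exprn_ge0.
rewrite -(bigA_distr_bigA (fun _ (c : bool * 'I_N.+1) => q ^+ c.2)) /=.
rewrite prodr_const card_ord lerXn2r ?nnegrE //.
- by apply: sumr_ge0 => c _; rewrite exprn_ge0.
- by rewrite divr_ge0 // subr_ge0 ltW.
rewrite -(pair_bigA _ (fun (_ : bool) (k : 'I_N.+1) => q ^+ k)) /=.
rewrite sumr_const card_bool -[_ *+ 2]mulr_natl ler_pM2l //.
exact: geometric_sum_le.
Qed.

Lemma edist_ge_coord (R : realType) (d : nat) (x y : 'rV[int]_d) (i : 'I_d) :
  (absz (x 0 i - y 0 i)%R)%:R <= edist R x y.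
Proof.
rewrite natr_absz intr_norm -sqrtr_sqr ler_sqrt.
  rewrite (bigD1 i) //= lerDl.
  by apply: sumr_ge0 => j _; exact: sqr_ge0.
by apply: sumr_ge0 => j _; exact: sqr_ge0.
Qed.

(** The Euclidean distance dominates each coordinate difference, hence their average; this is where
    the rate [a / d] comes from. *)
Lemma expR_edist_le (R : realType) (d : nat) (a : R) (x y : 'rV[int]_d) :
  (0 < d)%N -> 0 < a ->
  expR (- a * edist R x y) <=
    \prod_(i < d) expR (- (a / d%:R)) ^+ absz ((y - x)%R 0%R i).
Proof.
move=> d0 a0; have d0' : 0 < d%:R :> R by rewrite ltr0n.
under eq_bigr do rewrite -expRM_natl.
rewrite -expR_sum ler_expR -mulr_suml mulrN mulNr lerN2.
rewrite mulrCA ler_pM2l // ler_pdivrMr //.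
have -> : edist R x y * d%:R = \sum_(i < d) edist R x y.
  by rewrite sumr_const card_ord mulr_natr.
apply: ler_sum => i _.
by rewrite !mxE distnC edist_ge_coord.
Qed.

Lemma sum_expR_edist_le (R : realType) (d : nat) (a : R) (I : finType)
    (z : I -> 'rV[int]_d) (x : 'rV[int]_d) :
  (0 < d)%N -> 0 < a -> injective z ->
  \sum_k expR (- a * edist R x (z k)) <=
    (2 / (1 - expR (- (a / d%:R)))) ^+ d.
Proof.
move=> d0 a0 zI.
apply: (le_trans (ler_sum _ (fun k _ => expR_edist_le x (z k) d0 a0))).
apply: (lattice_sum_le (z := fun k => z k - x)) => [|k l /addIr/zI//].
by rewrite expR_ge0 expR_lt1 oppr_lt0 divr_gt0 // ltr0n.
Qed.

Lemma double_ord_ind (n : nat) (P : 'I_(n.*2) -> Prop) :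
  (forall j, P (pair_fst j)) -> (forall j, P (pair_snd j)) -> forall i, P i.
Proof.
move=> P1 P2 i.
have i2 : (i./2 < n)%N by rewrite ltn_half_double.
have := odd_double_half i; case: odd => /= Ei.
- by have := P2 (Ordinal i2); congr P; apply: val_inj.
- by have := P1 (Ordinal i2); congr P; apply: val_inj.
Qed.

Lemma sum_perm_pairs_le (R : numFieldType) (n : nat)
    (w : 'I_(n.*2) -> 'I_(n.*2) -> R) (S : R) :
  (forall j k, 0 <= w j k) -> (forall j, \sum_k w j k <= S) ->
  n`!%:R^-1 *
    \sum_(s : 'S_(n.*2)) \prod_(j < n) w (s (pair_fst j)) (s (pair_snd j))
    <= (4 * S) ^+ n.
Proof.
move=> w0 wS.
pose T := {ffun 'I_n -> 'I_(n.*2)}.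
pose h (s : 'S_(n.*2)) : T * T :=
  ([ffun j => s (pair_fst j)], [ffun j => s (pair_snd j)]).
pose F (p : T * T) := \prod_(j < n) w (p.1 j) (p.2 j).
have hI : injective h.
  move=> s t [/ffunP st1 /ffunP st2]; apply/permP; apply: double_ord_ind => j.
  - by have := st1 j; rewrite !ffunE.
  - by have := st2 j; rewrite !ffunE.
have sumF : \sum_(s : 'S_(n.*2)) F (h s) <= ((n.*2) ^_ n)%:R * S ^+ n.
  apply: le_trans (ler_sum_inj (P := fun p : T * T => injectiveb p.1) hI _ _) _.
  - move=> s; apply/injectiveP => i j; rewrite !ffunE => /perm_inj/(congr1 val)/=.
    by move/double_inj/val_inj.
  - by move=> p _; apply: prodr_ge0.
  (* The trivial conjunct gives the predicate product form, so the sum splits into injective [f] and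
     arbitrary [g]. *)
  rewrite (eq_bigl (fun p : T * T => injectiveb p.1 && true)) => [|p].
    rewrite -(pair_big (fun f : T => injectiveb f) xpredT
      (fun f g : T => \prod_(j < n) w (f j) (g j))) /=.
    have := card_inj_ffuns 'I_n 'I_(n.*2); rewrite !card_ord cardsE => <-.
    rewrite mulr_natl -sumr_const; apply: ler_sum => f _.
    rewrite -(bigA_distr_bigA (fun j k => w (f j) k)) /=.
    rewrite -[X in S ^+ X]card_ord -prodr_const; apply: ler_prod => j _.
    by rewrite wS sumr_ge0.
  by rewrite andbT.
have -> : \sum_(s : 'S_(n.*2)) \prod_(j < n) w (s (pair_fst j)) (s (pair_snd j))
    = \sum_(s : 'S_(n.*2)) F (h s).
  by apply: eq_bigr => s _; apply: eq_bigr => j _; rewrite !ffunE.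
(* For positive [n], [S] bounds a sum of nonnegative weights; for [n = 0] the power is 1. *)
have Sn0 : 0 <= S ^+ n.
  case: n w S w0 wS {T h F hI sumF} => [|n] w S w0 wS; first by rewrite expr0.
  apply: exprn_ge0; apply: le_trans (wS ord0); exact: sumr_ge0.
rewrite mulrC ler_pdivrMr ?ltr0n ?fact_gt0 //; apply: le_trans sumF _.
(* The falling factorial is ['C(n.*2, n)] times [n!], which absorbs the normalisation; the binomial
   is at most [2 ^ (2 * n) = 4 ^ n]. *)
rewrite -bin_ffact natrM exprMn mulrAC ler_wpM2r ?ler0n //.
rewrite ler_wpM2r // -(natrX _ 4) ler_nat (_ : 4 = 2 ^ 2)%N // -expnM mul2n.
exact: leq_bin_exp2.
Qed.

Theorem theorem1p3 (R : realType) (d : nat) (C mu : R) :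
  (1 <= d)%N -> 0 < C -> 0 < mu ->
  exists2 K : R, 0 < K &
    forall (n : nat) (x : 'I_(n.*2) -> 'rV[int]_d) (m : 'M[complex R]_(n.*2)),
      (1 <= n)%N ->
      injective x ->
      (forall j k, Normc.normc (m j k) <= C * expR (- mu * edist R (x j) (x k))) ->
      (n`!%:R)^-1 *
        \sum_(s : 'S_(n.*2))
          \prod_(j < n) Normc.normc (m (s (pair_fst j)) (s (pair_snd j)))
      <= K ^+ n * expR (- (mu / (2 * Num.sqrt d%:R)) * Ds R x).
Proof.
move=> d1 C0 mu0; pose a := mu / 2.
have a0 : 0 < a by rewrite divr_gt0.
pose S := (2 / (1 - expR (- (a / d%:R)))) ^+ d.
have S0 : 0 < S.
  by rewrite exprn_gt0 // divr_gt0 // subr_gt0 expR_lt1 oppr_lt0 divr_gt0 // ltr0n.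
(* Per pair: [C] from the bound on [m], 4 from the choice of first elements, [S] from the lattice
   sum at rate [mu / 2]. *)
exists (C * (4 * S)) => [|n x m _ xI mC]; first by rewrite !mulr_gt0.
pose w j k := expR (- a * edist R (x j) (x k)).
pose D := expR (- (mu / (2 * Num.sqrt d%:R)) * Ds R x).
have edist0 y z : 0 <= edist R (y : 'rV[int]_d) z by exact: sqrtr_ge0.
have sumw : n`!%:R^-1 *
    \sum_(s : 'S_(n.*2)) \prod_(j < n) w (s (pair_fst j)) (s (pair_snd j))
    <= (4 * S) ^+ n.
  by apply: sum_perm_pairs_le => [j k|j]; [exact: expR_ge0|exact: sum_expR_edist_le].
have Dle (s : 'S_(n.*2)) :
    \prod_(j < n) w (s (pair_fst j)) (s (pair_snd j)) <= D.
  rewrite -expR_sum -mulr_sumr ler_expR !mulNr lerN2.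
  have DsL : Ds R x <= pairing_length R x s by exact: bigmin_le.
  (* Nonnegativity allows the inequalities for the rates and for the lengths to be multiplied. *)
  have Ds0 : 0 <= Ds R x.
    by apply/bigmin_geP; split=> [|t _]; apply: sumr_ge0 => j _.
  apply: ler_pM => //; first by rewrite divr_ge0 ?mulr_ge0 ?sqrtr_ge0 ?ltW.
  rewrite ler_pM2l // lef_pV2 ?posrE ?mulr_gt0 ?sqrtr_gt0 ?ltr0n //.
  by rewrite ler_peMr // -[leLHS]sqrtr1 ler_sqrt ?ler1n.
have term (s : 'S_(n.*2)) :
    \prod_(j < n) Normc.normc (m (s (pair_fst j)) (s (pair_snd j))) <=
    C ^+ n * D * \prod_(j < n) w (s (pair_fst j)) (s (pair_snd j)).
  (* The decay at rate [mu] is split into two equal halves: one is bounded by [D], the other is kept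
     for the summation. *)
  apply: (@le_trans _ _ (C ^+ n *
    \prod_(j < n) w (s (pair_fst j)) (s (pair_snd j)) *
    \prod_(j < n) w (s (pair_fst j)) (s (pair_snd j)))).
    rewrite -[X in C ^+ X](card_ord n) -prodr_const -!big_split /=.
    apply: ler_prod => j _; rewrite -mulrA -expRD -mulrDl -opprD -splitr mC.
    by rewrite andbT; case: (m _ _) => u v; rewrite /Normc.normc sqrtr_ge0.
  rewrite ler_wpM2r ?ler_wpM2l ?exprn_ge0 //; last exact: ltW.
  by apply: prodr_ge0 => j _; exact: expR_ge0.
apply: (@le_trans _ _ (C ^+ n * D * (n`!%:R^-1 *
    \sum_(s : 'S_(n.*2)) \prod_(j < n) w (s (pair_fst j)) (s (pair_snd j))))).
  rewrite mulrCA ler_wpM2l ?invr_ge0 ?ler0n // mulr_sumr.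
  by apply: ler_sum => s _.
rewrite exprMn [leRHS]mulrAC ler_wpM2l // mulr_ge0 ?expR_ge0 //.
by rewrite exprn_ge0 // ltW.
Qed.
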